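(* There is a $16\,CS\to2\,CS$ distillation protocol at distance $3$: let $G\in\mathbb F_4^{5\times16}$ have columns indexed by $(x,y)\in\mathbb F_4^2$ and rows the evaluations of $$y^3+\omega x^3,\quad xy\ \text{(logical rows)},\qquad x,\quad y,\quad1\ \text{(stabilizer rows)}.$$ Then $G$ has full rank and satisfies $$\sum_ig_{a,i}g_{b,i}g_{c,i}=\begin{cases}1&1\le a=b=c\le2\\0&\text{otherwise}\end{cases}\qquad(1\le a,b,c\le5);$$ consequently $D_G=C\,(CS^{\otimes2}\otimes I)$ for some diagonal Clifford unitary $C$ ($CS^{\otimes 2}$ acting on the first two qudits); and the $Z$-distance of the code is $3$.
   Context: $\mathbb F_4=\{0,1,\omega,\omega^2\}$, $\omega^2=\omega+1$. Writing $\gamma=b_1\omega+b_2\omega^2$ ($b_1,b_2\in\{0,1\}$) identifies an $\mathbb F_4$-qudit with two qubits, and $CS|\gamma\rangle=i^{b_1b_2}|\gamma\rangle$; put $c(\gamma)=b_1b_2$. A full-rank matrix $G\in\mathbb F_4^{m\times n}$ with $k$ logical rows defines a CSS code on $n$ $\mathbb F_4$-qudits: the first $k$ rows are $X$-logical operators, the last $m-k$ rows are $X$-stabilizer generators. Its $Z$-distance is the minimum Hamming weight over $\mathbb F_4$ of a vector in $\mathbb F_4^n$ orthogonal (for $\sum x_iy_i$) to all stabilizer rows but not to at least one logical row. The unitary on $m$ qudits ($2m$ qubits) induced by applying $CS$ to each of the $n$ physical qudits is $D_G|u\rangle=i^{\sum_{i=1}^nc(\sum_au_ag_{a,i})}|u\rangle$,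 $u\in\mathbb F_4^m$ (inner sum in $\mathbb F_4$, outer sum over integers). *)

(* Defs.v *)
From HB Require Import structures.
From mathcomp Require Import all_boot all_order all_algebra all_field.
From mathcomp Require Import sesquilinear spectral.

Set Implicit Arguments.
Unset Strict Implicit.
Unset Printing Implicit Defensive.

Import Order.TTheory GRing.Theory Num.Theory.
Local Open Scope ring_scope.
Local Open Scope sesquilinear_scope.

Section QuditsAsQubits.

(* F stands for the field with four elements and w for omega; both conditions
   are hypotheses of the statements. *)
Variables (F : finFieldType) (w : F).

(* The bits (b1, b2) with g = b1 * omega + b2 * omega^2.  When #|F| = 4 and
   omega^2 = omega + 1 they exist and are unique, so the default value of odflt
   plays no role. *)
Definition bits (g : F) : bool * bool :=
  odflt (false, false)
    [pick b : bool * bool | g == b.1%:R * w + b.2%:R * w ^+ 2].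

Definition c (g : F) : nat := ((bits g).1 * (bits g).2)%N.

(* The computational basis of m qudits is indexed by F^m.  The 2m underlying
   qubits are indexed by 'I_m * bool: (a, false) carries the bit b1 of the a-th
   qudit and (a, true) carries its bit b2. *)
Definition qubit (m : nat) (u : 'rV[F]_m) (q : 'I_m * bool) : bool :=
  if q.2 then (bits (u 0 q.1)).2 else (bits (u 0 q.1)).1.

Variable C : numClosedFieldType.

(* The operator on C^T with matrix entries <v|A|u> = A v u. *)
Definition opmx (T : finType) (A : T -> T -> C) : 'M[C]_#|T| :=
  \matrix_(i, j) A (enum_val i) (enum_val j).

Definition diagop (T : finType) (f : T -> C) : 'M[C]_#|T| :=
  opmx (fun v u => f u *+ (v == u)).

Definition tensor (m : nat) (A : 'I_m -> 'M[C]_#|F|) : 'M[C]_#|{: 'rV[F]_m}| :=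
  opmx (fun v u : 'rV[F]_m =>
    \prod_(a < m) A a (enum_rank (v 0 a)) (enum_rank (u 0 a))).

Definition CS : 'M[C]_#|F| := diagop (fun g : F => 'i ^+ c g).

(* CS^{(x) k} (x) I on m qudits. *)
Definition CS_first (m k : nat) : 'M[C]_#|{: 'rV[F]_m}| :=
  tensor (fun a : 'I_m => if (a < k)%N then CS else 1%:M).

Definition D (m n : nat) (G : 'M[F]_(m, n)) : 'M[C]_#|{: 'rV[F]_m}| :=
  diagop (fun u : 'rV[F]_m => 'i ^+ (\sum_(i < n) c ((u *m G) ord0 i))%N).

(* The entry <t|X^x Z^z|s> for the single-qubit Pauli matrices X and Z. *)
Definition pauli1 (x z t s : bool) : C := (-1) ^+ (z && s) *+ (t == s (+) x).

(* The elements i^l prod_q X_q^{x_q} Z_q^{z_q} of the Pauli group on 2m qubits. *)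
Definition pauli (m l : nat) (x z : 'I_m * bool -> bool) :
    'M[C]_#|{: 'rV[F]_m}| :=
  opmx (fun v u : 'rV[F]_m =>
    'i ^+ l * \prod_q pauli1 (x q) (z q) (qubit v q) (qubit u q)).

Definition is_pauli (m : nat) (P : 'M[C]_#|{: 'rV[F]_m}|) : Prop :=
  exists (l : nat) (x z : 'I_m * bool -> bool), P = pauli l x z.

Definition clifford (m : nat) (U : 'M[C]_#|{: 'rV[F]_m}|) : Prop :=
  U \is unitarymx /\
  forall P : 'M[C]_#|{: 'rV[F]_m}|, is_pauli P -> is_pauli (U *m P *m U ^t*).

End QuditsAsQubits.

Section Distance.

Variables (F : finFieldType) (m n : nat).

Definition hamming_weight (z : 'rV[F]_n) : nat := #|[set i | z ord0 i != 0]|.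

Definition rowdot (G : 'M[F]_(m, n)) (a : 'I_m) (z : 'rV[F]_n) : F :=
  \sum_(i < n) z ord0 i * G a i.

(* The first k rows of G are the logical ones, the others the stabilizers. *)
Definition Z_logical (k : nat) (G : 'M[F]_(m, n)) (z : 'rV[F]_n) : Prop :=
  (forall a : 'I_m, (k <= a)%N -> rowdot G a z = 0) /\
  (exists2 a : 'I_m, (a < k)%N & rowdot G a z != 0).

Definition Z_distance_is (k : nat) (G : 'M[F]_(m, n)) (d : nat) : Prop :=
  (exists2 z : 'rV[F]_n, Z_logical k G z & hamming_weight z = d) /\
  (forall z : 'rV[F]_n, Z_logical k G z -> (d <= hamming_weight z)%N).

End Distance.

(* The generator matrix; col enumerates the column labels (x, y). *)
Definition G16 (F : finFieldType) (w : F) (col : 'I_16 -> F * F) :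
    'M[F]_(5, 16) :=
  \matrix_(a < 5, i < 16)
    let x := (col i).1 in let y := (col i).2 in
    [:: y ^+ 3 + w * x ^+ 3; x * y; x; y; 1]`_a.

(* Main.v *)
Require Import Defs.
From HB Require Import structures.
From mathcomp Require Import all_boot all_order all_algebra all_field.
From mathcomp Require Import sesquilinear spectral.
From mathcomp Require Import ring.

Set Implicit Arguments.
Unset Strict Implicit.
Unset Printing Implicit Defensive.

Import Order.TTheory GRing.Theory Num.Theory.
Local Open Scope ring_scope.

(* In bits, CS has phase phi(g) = i^c(g), and with chi(g) = (-1)^Tr(g) one has
     phi(x+y+z) phi(x) phi(y) phi(z) = phi(x+y) phi(x+z) phi(y+z) chi(xyz),
     phi(x+y)^2 = phi(x)^2 phi(y)^2 chi(xyy).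
   Multiplied over the columns of G, the arguments of chi add up to the
   trilinear form sum_i (uG)_i (vG)_i (hG)_i, which triorthogonality makes equal
   to u_1 v_1 h_1 + u_2 v_2 h_2.  The phases of D_G and of CS on the first two
   qudits thus have the same cubic part, and their quotient Q satisfies both
   identities without chi: Q(u+h) / (Q(u) Q(h)) is a sign character of u, so
   diag(Q) conjugates Pauli operators to Pauli operators. *)

Local Open Scope sesquilinear_scope.

(** * Arithmetic of F_4 in bit coordinates and the phase of [CS] *)

Section FieldOfFourElements.

Variables (F : finFieldType) (w : F).
Hypotheses (cardF : #|F| = 4%N) (hw : w ^+ 2 = w + 1).

Definition of_bits (b : bool * bool) : F := b.1%:R * w + b.2%:R * w ^+ 2.

Definition bits_add (a b : bool * bool) : bool * bool :=
  (a.1 (+) b.1, a.2 (+) b.2).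

(* From omega * omega^2 = omega + omega^2 and omega^2 * omega^2 = omega. *)
Definition bits_mul (a b : bool * bool) : bool * bool :=
  let s := (a.1 && b.2) (+) (a.2 && b.1) in
  ((a.2 && b.2) (+) s, (a.1 && b.1) (+) s).

(** Every element of F is fixed by the power [#|F|], so [-1 = (-1) ^+ 4 = 1]. *)
Lemma addFF (x : F) : x + x = 0.
Proof.
have : (-1 : F) ^+ 4 = -1 by rewrite -cardF expf_card.
rewrite -signr_odd expr0 => eq1N.
by rewrite -mulr2n -mulr_natr mulr2n {2}eq1N subrr mulr0.
Qed.

Lemma omega_neq0 : w != 0.
Proof.
apply/eqP => w0; move/eqP: hw.
by rewrite w0 expr0n add0r eq_sym oner_eq0.
Qed.

Lemma omega_neq1 : w != 1.
Proof.
by apply/eqP => w1; move/eqP: hw; rewrite w1 expr1n addFF oner_eq0.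
Qed.

Lemma natr_addb (x y : bool) : (x (+) y)%:R = x%:R + y%:R :> F.
Proof. by case: x y => [] [] /=; rewrite ?addr0 ?add0r ?addFF. Qed.

Lemma of_bits_add (a b : bool * bool) :
  of_bits (bits_add a b) = of_bits a + of_bits b.
Proof.
by rewrite /of_bits /= !natr_addb; ring.
Qed.

Lemma omega3 : w ^+ 3 = 1.
Proof. by rewrite exprS hw mulrDr mulr1 -expr2 hw addrAC addFF add0r. Qed.

(** By additivity it is enough that the kernel is trivial: the three nonzero pairs go to
    [w + w ^+ 2 = 1], [w] and [w ^+ 2], none of which is 0. *)
Lemma of_bits_inj : injective of_bits.
Proof.
have ker0 (a : bool * bool) : of_bits a = 0 -> a = (false, false).
  case: a => [[] []] // /eqP; rewrite /of_bits /= ?mul1r ?mul0r ?addr0 ?add0r.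
  - by rewrite hw addrA addFF add0r oner_eq0.
  - by rewrite (negPf omega_neq0).
  - by rewrite expf_eq0 (negPf omega_neq0).
move=> a b eq_ab.
have /ker0 : of_bits (bits_add a b) = 0 by rewrite of_bits_add eq_ab addFF.
by case: a b {eq_ab} => [[] []] [[] []].
Qed.

Lemma of_bits_bij : bijective of_bits.
Proof.
by apply: inj_card_bij of_bits_inj _; rewrite cardF card_prod card_bool.
Qed.

Lemma of_bitsK : cancel of_bits (bits w).
Proof.
move=> b; rewrite /bits; case: pickP => [b' /eqP eq_b|/(_ b)] /=.
  exact/esym/of_bits_inj.
by rewrite eqxx.
Qed.

Lemma bitsK : cancel (bits w) of_bits.
Proof. exact: (bij_can_sym of_bits_bij _).2 of_bitsK. Qed.

Lemma of_bits_mul (a b : bool * bool) :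
  of_bits (bits_mul a b) = of_bits a * of_bits b.
Proof.
have natM (x y : bool) : (x && y)%:R = x%:R * y%:R :> F.
  by case: x y => [] [] /=; rewrite ?mulr0 ?mulr1.
have w4 : w ^+ 2 * w ^+ 2 = w by rewrite -exprD exprS omega3 mulr1.
have w1 : w * w ^+ 2 = w + w ^+ 2 by rewrite -exprS omega3 hw addrA addFF add0r.
rewrite /of_bits /= !natr_addb !natM.
transitivity (a.1%:R * b.1%:R * w ^+ 2 + a.2%:R * b.2%:R * (w ^+ 2 * w ^+ 2)
   + (a.1%:R * b.2%:R + a.2%:R * b.1%:R) * (w * w ^+ 2)); last by ring.
by rewrite w4 w1; ring.
Qed.

Lemma bitsD (x y : F) : bits w (x + y) = bits_add (bits w x) (bits w y).
Proof. by apply: of_bits_inj; rewrite of_bits_add !bitsK. Qed.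

Lemma bitsM (x y : F) : bits w (x * y) = bits_mul (bits w x) (bits w y).
Proof. by apply: of_bits_inj; rewrite of_bits_mul !bitsK. Qed.

Lemma bits0 : bits w 0 = (false, false).
Proof. by apply: of_bits_inj; rewrite bitsK /of_bits /= !mul0r addr0. Qed.

Lemma bits1 : bits w 1 = (true, true).
Proof.
by apply: of_bits_inj; rewrite bitsK /of_bits /= !mul1r hw addrA addFF add0r.
Qed.

Lemma bits_omega : bits w w = (true, false).
Proof. by apply: of_bits_inj; rewrite bitsK /of_bits /= mul1r mul0r addr0. Qed.

Lemma sum_of_bits (f : F -> F) : \sum_x f x =
  f (of_bits (true, true)) + f (of_bits (true, false))
  + (f (of_bits (false, true)) + f (of_bits (false, false))).
Proof.
rewrite (reindex of_bits) /=; last exact/onW_bij/of_bits_bij.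
by rewrite -(pair_bigA _ (fun x y => f (of_bits (x, y)))) !big_bool.
Qed.

Variable C : numClosedFieldType.

Definition phase (x : F) : C := 'i ^+ c w x.

(* b1 + b2 is the trace of b1 * omega + b2 * omega^2 from F_4 to F_2. *)
Definition trace_sign (x : F) : C := (-1) ^+ ((bits w x).1 (+) (bits w x).2).

Lemma trace_signD (x y : F) :
  trace_sign (x + y) = trace_sign x * trace_sign y.
Proof.
rewrite /trace_sign bitsD -signr_addb /=.
by case: (bits w x) (bits w y) => [[] []] [[] []].
Qed.

Lemma trace_sign0 : trace_sign 0 = 1.
Proof. by rewrite /trace_sign bits0. Qed.

(** The square of [phase] is (-1)^(b1 b2). The polar form of b1 b2 is a1 b2 + a2 b1, which equals
    Tr(x y^2). *)
Lemma phase_square_add (x y : F) :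
  phase (x + y) ^+ 2 = phase x ^+ 2 * phase y ^+ 2 * trace_sign (x * y * y).
Proof.
rewrite /phase /trace_sign /c !bitsM bitsD.
have i2 : ('i * 'i : C) = -1 by rewrite -expr2 sqrCi.
by case: (bits w x) (bits w y) => [[] []] [[] []] /=; ring: i2.
Qed.

(** As a phase, i^(b1 b2) has degree three: its third difference at 0 is the sign of the symmetric
    trilinear form Tr(xyz). The terms are distributed over both sides so that no inverse occurs. *)
Lemma phase_cubic (x y z : F) :
  phase (x + y + z) * (phase x * phase y * phase z) =
  phase (x + y) * phase (x + z) * phase (y + z) * trace_sign (x * y * z).
Proof.
rewrite /phase /trace_sign /c !bitsM !bitsD.
have i2 : ('i * 'i : C) = -1 by rewrite -expr2 sqrCi.
by case: (bits w x) (bits w y) (bits w z) => [[] []] [[] []] [[] []] /=;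
  ring: i2.
Qed.

End FieldOfFourElements.

(** * Products, adjoints and tensor products of diagonal operators *)

Section DiagonalOperators.

Variable C : numClosedFieldType.

Lemma eq_opmx (T : finType) (A B : T -> T -> C) :
  (forall v u, A v u = B v u) -> opmx A = opmx B.
Proof. by move=> eqAB; apply/matrixP=> i j; rewrite !mxE. Qed.

Lemma mul_opmx (T : finType) (A B : T -> T -> C) :
  opmx A *m opmx B = opmx (fun v u => \sum_t A v t * B t u).
Proof.
apply/matrixP=> i j; rewrite !mxE [RHS]big_enum_val /=.
by apply: eq_bigr => k _; rewrite !mxE.
Qed.

Lemma mul_diagop_opmx (T : finType) (f : T -> C) (A : T -> T -> C) :
  diagop f *m opmx A = opmx (fun v u => f v * A v u).
Proof.
rewrite mul_opmx; apply: eq_opmx => v u.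
rewrite (bigD1 v) //= eqxx mulr1n big1 ?addr0 // => t neq_tv.
by rewrite eq_sym (negPf neq_tv) mulr0n mul0r.
Qed.

Lemma mul_opmx_diagop (T : finType) (A : T -> T -> C) (f : T -> C) :
  opmx A *m diagop f = opmx (fun v u => A v u * f u).
Proof.
rewrite mul_opmx; apply: eq_opmx => v u.
rewrite (bigD1 u) //= eqxx mulr1n big1 ?addr0 // => t neq_tu.
by rewrite (negPf neq_tu) mulr0n mulr0.
Qed.

Lemma mul_diagop (T : finType) (f g : T -> C) :
  diagop f *m diagop g = diagop (fun u => f u * g u).
Proof.
rewrite mul_diagop_opmx; apply: eq_opmx => v u.
by case: eqP => [->|_]; rewrite ?mulr1n ?mulr0n ?mulr0.
Qed.

Lemma diagop_is_diag (T : finType) (f : T -> C) : is_diag_mx (diagop f).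
Proof.
apply/is_diag_mxP=> i j neq_ij; rewrite mxE (inj_eq enum_val_inj).
by rewrite -val_eqE (negPf neq_ij) mulr0n.
Qed.

Lemma diagop1 (T : finType) : diagop (fun _ : T => 1) = 1%:M :> 'M[C]_#|T|.
Proof. by apply/matrixP=> i j; rewrite !mxE (inj_eq enum_val_inj). Qed.

Lemma eq_diagop (T : finType) (f g : T -> C) : f =1 g -> diagop f = diagop g.
Proof. by move=> eqfg; apply: eq_opmx => v u; rewrite eqfg. Qed.

Lemma adjoint_diagop (T : finType) (f : T -> C) :
  (diagop f)^t* = diagop (fun u => (f u)^*).
Proof.
apply/matrixP=> i j; rewrite !mxE eq_sym.
by case: eqP => [->|_]; rewrite ?mulr1n // !mulr0n rmorph0.
Qed.

Lemma diagop_unitary (T : finType) (f : T -> C) :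
  (forall u, f u * (f u)^* = 1) -> diagop f \is unitarymx.
Proof.
move=> normf; apply/unitarymxP.
by rewrite adjoint_diagop mul_diagop -diagop1; apply: eq_diagop.
Qed.

(** Off the diagonal, [v] and [u] differ at some qudit, whose tensor factor contributes 0. *)
Lemma CS_firstE (F : finFieldType) (w : F) (m k : nat) :
  CS_first w C m k =
  diagop (fun u : 'rV[F]_m => \prod_(a < m | (a < k)%N) phase w C (u 0 a)).
Proof.
apply: eq_opmx => v u.
have entry (a : 'I_m) : (if (a < k)%N then CS w C else 1%:M)
    (enum_rank (v 0 a)) (enum_rank (u 0 a)) =
    (if (a < k)%N then phase w C (u 0 a) else 1) *+ (v 0 a == u 0 a).
  by case: ifP => _; rewrite !mxE ?enum_rankK // (inj_eq enum_rank_inj).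
under eq_bigr => a _ do rewrite entry.
case: eqP => [->|neq_vu].
  by rewrite [RHS]big_mkcond; apply: eq_bigr => a _; rewrite eqxx.
have [a neq_a] : exists a, v 0 a != u 0 a.
  apply/existsP; apply: contra_notT neq_vu => /existsPn eq_vu.
  by apply/rowP => a; apply/eqP/negPn/eq_vu.
by rewrite (bigD1 a) //= (negPf neq_a) mulr0n mul0r.
Qed.

End DiagonalOperators.

(** * Pauli operators and a Clifford criterion for diagonal unitaries *)

Section DiagonalClifford.

Variables (F : finFieldType) (w : F) (C : numClosedFieldType).
Hypotheses (cardF : #|F| = 4%N) (hw : w ^+ 2 = w + 1).

Let qubitD m (u v : 'rV[F]_m) q :
  qubit w (u + v) q = qubit w u q (+) qubit w v q.
Proof. by rewrite /qubit mxE (bitsD cardF hw); case: q.2. Qed.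

Definition row_of_qubits m (x : 'I_m * bool -> bool) : 'rV[F]_m :=
  \row_a of_bits w (x (a, false), x (a, true)).

Let qubit_row_of_qubits m (x : 'I_m * bool -> bool) q :
  qubit w (row_of_qubits x) q = x q.
Proof. by case: q => a [] /=; rewrite /qubit /= mxE (of_bitsK cardF hw). Qed.

Lemma qubit_inj m (u v : 'rV[F]_m) : qubit w u =1 qubit w v -> u = v.
Proof.
move=> eq_uv; apply/rowP=> a.
rewrite -[u 0 a](bitsK cardF hw) -[v 0 a](bitsK cardF hw); congr of_bits.
have := eq_uv (a, false); have := eq_uv (a, true); rewrite /qubit /=.
by case: (bits w (u 0 a)) (bits w (v 0 a)) => [? ?] [? ?] /= -> ->.
Qed.

Let qubit0 m q : qubit w (0 : 'rV[F]_m) q = false.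
Proof. by rewrite /qubit mxE (bits0 cardF hw); case: q.2. Qed.

Definition qubit_vector m (q : 'I_m * bool) : 'rV[F]_m :=
  row_of_qubits (pred1 q).

(** Expansion in the basis over F_2 given by the qubits; it reduces a character of F^m to its values
    on that basis. *)
Lemma sum_qubit_vectors m (u : 'rV[F]_m) :
  u = \sum_(q | qubit w u q) qubit_vector q.
Proof.
apply: qubit_inj => q.
rewrite (big_morph (fun v : 'rV[F]_m => qubit w v q)
  (fun v v' => qubitD v v' q) (qubit0 q)).
under eq_bigr => q' _ do rewrite qubit_row_of_qubits /=.
case uq: (qubit w u q).
  by rewrite (bigD1 q) //= eqxx big1 // => q' /andP[_ /negPf]; rewrite eq_sym.
by rewrite big1 // => q'; case: eqP => [<-|//]; rewrite uq.
Qed.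

(** The X part translates basis labels by the vector with bits [x]; the Z part is a sign character
    of [u]. *)
Lemma pauliE m (l : nat) (x z : 'I_m * bool -> bool) :
  pauli w C l x z = opmx (fun v u : 'rV[F]_m =>
    ('i ^+ l * \prod_(q | qubit w u q) (-1) ^+ z q)
      *+ (v == u + row_of_qubits x)).
Proof.
apply: eq_opmx => v u; rewrite /pauli1.
case: eqP => [->|neq_v].
  rewrite [in RHS]big_mkcond /=; congr (_ * _); apply: eq_bigr => q _.
  rewrite qubitD qubit_row_of_qubits eqxx mulr1n.
  by case: (qubit w u q); rewrite ?andbT ?andbF.
have [q neq_q] : exists q, qubit w v q != (qubit w u q (+) x q).
  apply/existsP; apply: contra_notT neq_v => /existsPn eq_v.
  apply: qubit_inj => q; rewrite qubitD qubit_row_of_qubits.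
  exact/eqP/negPn/eq_v.
by rewrite (bigD1 q) //= (negPf neq_q) mulr0n mul0r mulr0.
Qed.

(** The cubic identity makes [Q (u + h) / (Q u * Q h)] multiplicative in [u], and the square
    identity makes it a sign. [Q] is a power of ['i] so that the leftover scalar [Q h] is absorbed
    by the prefactor ['i ^+ l] of a Pauli operator. *)
Lemma diagop_clifford m (e : 'rV[F]_m -> nat) (Q := fun u => 'i ^+ e u : C) :
  (forall u v, Q (u + v) ^+ 2 = Q u ^+ 2 * Q v ^+ 2) ->
  (forall u v h, Q (u + v + h) * (Q u * Q v * Q h) =
     Q (u + v) * Q (u + h) * Q (v + h)) ->
  clifford w (diagop Q).
Proof.
move=> Qsqr Qcub.
have normQ u : Q u * (Q u)^* = 1.
  by rewrite -normCK normrX normCi expr1n expr1n.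
have Q0 u : Q u != 0 by rewrite expf_neq0 ?neq0Ci.
split; first exact: diagop_unitary.
move=> P [l [x [z ->]]]; set h := row_of_qubits x.
(* Conjugating X^h by diag(Q) multiplies it by the phase Q(u + h) / Q(u), which
   is Q(h) times the sign character B. *)
pose B u : C := Q (u + h) / (Q u * Q h).
have BD u v : B (u + v) = B u * B v.
  have : B (u + v) * (Q (u + v) * Q h) = Q (u + v + h).
    by rewrite divfK // mulf_neq0.
  move=> defB; have defBu : Q (u + h) = B u * (Q u * Q h).
    by rewrite divfK // mulf_neq0.
  have defBv : Q (v + h) = B v * (Q v * Q h) by rewrite divfK // mulf_neq0.
  have := Qcub u v h; rewrite -defB defBu defBv => eqB.
  have nz : Q (u + v) * Q h * (Q u * Q v * Q h) != 0 by rewrite !mulf_neq0.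
  by apply: (mulIf nz); rewrite [LHS]mulrA eqB; ring.
have Bsqr u : B u ^+ 2 = 1.
  by rewrite expr_div_n exprMn Qsqr divff // -exprMn expf_neq0 // mulf_neq0.
have B0 : B 0 = 1.
  have := BD 0 0; rewrite addr0 => /esym/eqP; rewrite -expr2 Bsqr.
  by rewrite eq_sym => /eqP.
(* A sign character is determined by its values on the qubit basis: [s] marks the qubits whose Z
   exponent is flipped. *)
pose s q := B (qubit_vector q) == -1.
have BE u : B u = \prod_(q | qubit w u q) (-1) ^+ s q.
  rewrite [in LHS](sum_qubit_vectors u) (big_morph B BD B0).
  apply: eq_bigr => q _; have /eqP := Bsqr (qubit_vector q).
  rewrite sqrf_eq1 /s; case: (boolP (_ == -1)) => [/eqP -> //|_].
  by rewrite orbF => /eqP.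
exists (l + e h)%N, x, (fun q => z q (+) s q).
rewrite adjoint_diagop !pauliE mul_diagop_opmx mul_opmx_diagop.
apply: eq_opmx => v u; case: eqP => [->|_]; last by rewrite !mulr0n mulr0 mul0r.
rewrite !mulr1n; under [in RHS]eq_bigr => q _ do rewrite signr_addb.
rewrite big_split /= -BE exprD -/(Q h).
have -> : Q (u + h) = B u * (Q u * Q h) by rewrite divfK // mulf_neq0.
by rewrite -[RHS]mulr1 -(normQ u); ring.
Qed.

End DiagonalClifford.

(** * Triorthogonality and rank of the generator matrix *)

Definition bits_pow (b : bool * bool) (n : nat) : bool * bool :=
  iter n (bits_mul b) (true, true).

(* The rows of G16 in bit coordinates, where sums over F_4^2 are computed. *)
Definition bits_row (a : nat) (x y : bool * bool) : bool * bool :=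
  nth (false, false)
    [:: bits_add (bits_pow y 3) (bits_mul (true, false) (bits_pow x 3));
        bits_mul x y; x; y; (true, true)] a.

Section Code.

Variables (F : finFieldType) (w : F) (col : 'I_16 -> F * F).
Hypotheses (cardF : #|F| = 4%N) (hw : w ^+ 2 = w + 1) (hcol : bijective col).

Let G := G16 w col.

Lemma sum_columns (f : F * F -> F) :
  \sum_(i < 16) f (col i) = \sum_x \sum_y f (x, y).
Proof.
rewrite pair_bigA /=; under [RHS]eq_bigr => p _ do rewrite -surjective_pairing.
by rewrite [RHS](reindex col) //; exact/onW_bij.
Qed.

Lemma of_bits1 : of_bits w (true, true) = 1.
Proof. by rewrite -(bits1 cardF hw) (bitsK cardF hw). Qed.

Lemma of_bits0 : of_bits w (false, false) = 0.
Proof. by rewrite -(bits0 cardF hw) (bitsK cardF hw). Qed.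

Lemma of_bits_pow (b : bool * bool) (n : nat) :
  of_bits w (bits_pow b n) = of_bits w b ^+ n.
Proof.
elim: n => [|n IHn]; first by rewrite of_bits1 expr0.
by rewrite [bits_pow _ _]/= (of_bits_mul cardF hw) -/(bits_pow b n) IHn exprS.
Qed.

Lemma G16_of_bits (a : 'I_5) (x y : bool * bool) :
  [:: of_bits w y ^+ 3 + w * of_bits w x ^+ 3; of_bits w x * of_bits w y;
      of_bits w x; of_bits w y; 1]`_a = of_bits w (bits_row a x y).
Proof.
have wE : of_bits w (true, false) = w.
  by rewrite -(bits_omega cardF hw) (bitsK cardF hw).
case: a => [[|[|[|[|[|]]]]]] //= _.
- by rewrite (of_bits_add w cardF) (of_bits_mul cardF hw) !of_bits_pow wE.
- by rewrite (of_bits_mul cardF hw).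
- by rewrite of_bits1.
Qed.

(** In bit coordinates both sides become [of_bits] of closed boolean expressions, so each of the 125
    index triples is settled by computation. *)
Lemma G16_triorthogonal (a b c : 'I_5) :
  \sum_(i < 16) G a i * G b i * G c i =
    (if [&& a == b, b == c & (a < 2)%N] then 1 else 0).
Proof.
pose entry (a : 'I_5) (p : F * F) :=
  [:: p.2 ^+ 3 + w * p.1 ^+ 3; p.1 * p.2; p.1; p.2; 1]`_a.
pose term p := entry a p * entry b p * entry c p.
transitivity (\sum_(i < 16) term (col i)).
  by apply: eq_bigr => i _; rewrite !mxE.
rewrite sum_columns /term /entry /=.
rewrite (sum_of_bits cardF hw) !(sum_of_bits cardF hw) !G16_of_bits.
rewrite -!(of_bits_mul cardF hw) -!(of_bits_add w cardF) -of_bits1 -of_bits0.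
rewrite -fun_if; congr of_bits; rewrite -!val_eqE; clear term.
by move: a b c => [[|[|[|[|[|a]]]]] //= _] [[|[|[|[|[|b]]]]] //= _]
  [[|[|[|[|[|c]]]]] //= _].
Qed.

(** After multilinear expansion over the rows, triorthogonality leaves only the diagonal logical
    triples. *)
Lemma G16_trilinear (u v h : 'rV[F]_5) :
  \sum_(i < 16) (u *m G) 0 i * (v *m G) 0 i * (h *m G) 0 i =
  \sum_(a < 5 | (a < 2)%N) u 0 a * v 0 a * h 0 a.
Proof.
transitivity (\sum_a \sum_b \sum_c
    u 0 a * v 0 b * h 0 c * \sum_(i < 16) G a i * G b i * G c i).
  under eq_bigr => i _.
    rewrite !mxE big_distrlr /= big_distrl /=.
    under eq_bigr => a _.
      rewrite big_distrl /=; under eq_bigr => b _ do rewrite big_distrr /=.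
      over.
    over.
  rewrite exchange_big; apply: eq_bigr => a _.
  rewrite exchange_big; apply: eq_bigr => b _.
  rewrite exchange_big; apply: eq_bigr => c _.
  by rewrite big_distrr; apply: eq_bigr => i _ /=; ring.
rewrite [RHS]big_mkcond; apply: eq_bigr => a _.
rewrite (bigD1 a) //= [X in _ + X]big1 ?addr0; last first.
  move=> b neq_ba; rewrite big1 // => c _.
  by rewrite G16_triorthogonal eq_sym (negPf neq_ba) mulr0.
rewrite (bigD1 a) //= [X in _ + X]big1 ?addr0; last first.
  move=> c neq_ca.
  by rewrite G16_triorthogonal eqxx eq_sym (negPf neq_ca) mulr0.
by rewrite G16_triorthogonal !eqxx /=; case: ifP; rewrite ?mulr1 ?mulr0.
Qed.

Lemma G16_rank : \rank G = 5%N.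
Proof.
apply/eqP/inj_row_free => u uG0.
(* Pairing [u] with two copies of the basis vector [e] in the trilinear form isolates [u 0 a]. *)
have logical0 (a : 'I_5) : (a < 2)%N -> u 0 a = 0.
  move=> lt_a2; pose e : 'rV[F]_5 := delta_mx 0 a.
  have := G16_trilinear u e e; rewrite uG0.
  rewrite big1 => [|i _]; last by rewrite mxE !mul0r.
  rewrite (bigD1 a) //= big1 => [|b /andP[_ neq_ba]]; last first.
    by rewrite !mxE (negPf neq_ba) !mulr0.
  by rewrite !mxE !eqxx !mulr1 addr0 => <-.
have [point _ pointK] := hcol.
have eval (x y : F) :
    u 0 (inord 2) * x + u 0 (inord 3) * y + u 0 (inord 4) = 0.
  have /rowP/(_ (point (x, y))) := uG0; rewrite !mxE !big_ord_recl big_ord0.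
  rewrite !mxE pointK /= (logical0 ord0) // (logical0 (lift ord0 ord0)) //.
  rewrite !mul0r !add0r addr0 mulr1 addrA => <-.
  by congr (u 0 _ * _ + u 0 _ * _ + u 0 _); apply/val_inj; rewrite /= inordK.
(* The remaining affine function vanishes on F^2; its values at (0,0), (0,1) and (1,0) give its
   coefficients. *)
have u4 : u 0 (inord 4) = 0 by have := eval 0 0; rewrite !mulr0 !add0r.
have u3 : u 0 (inord 3) = 0.
  by have := eval 0 1; rewrite mulr0 mulr1 add0r u4 addr0.
have u2 : u 0 (inord 2) = 0.
  by have := eval 1 0; rewrite mulr0 mulr1 u4 !addr0.
apply/rowP => a; rewrite mxE -[a]inord_val.
case: a => [[|[|[|[|[|]]]]]] //= lt_a; rewrite ?u2 ?u3 ?u4 //;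
  by apply: logical0; rewrite inordK.
Qed.

(** * The diagonal Clifford correction *)

Lemma G16_clifford (C : numClosedFieldType) :
  exists U : 'M[C]_#|{: 'rV[F]_5}|,
    [/\ is_diag_mx U, clifford w U & D w C G = U *m CS_first w C 5 2].
Proof.
pose code_phase (u : 'rV[F]_5) := \prod_(i < 16) phase w C ((u *m G) 0 i).
pose logical_phase (u : 'rV[F]_5) :=
  \prod_(a < 5 | (a < 2)%N) phase w C (u 0 a).
(* -1 = 3 mod 4: multiplying by the cube inverts the logical phase. *)
pose e (u : 'rV[F]_5) :=
  (\sum_(i < 16) c w ((u *m G) ord0 i)
   + 3 * \sum_(a < 5 | (a < 2)%N) c w (u ord0 a))%N.
have eE u : 'i ^+ e u = code_phase u * logical_phase u ^+ 3.
  rewrite exprD mulnC exprM; congr (_ * _ ^+ _).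
    by rewrite (big_morph _ (exprD _) (expr0 _)).
  by rewrite (big_morph _ (exprD _) (expr0 _)).
have i4 : 'i ^+ 4 = 1 :> C by rewrite (exprM _ 2 2) sqrCi sqrrN expr1n.
have logical4 u : logical_phase u ^+ 4 = 1.
  by rewrite -prodrXl big1 // => a _; rewrite -exprM mulnC exprM i4 expr1n.
have codeE u : code_phase u = 'i ^+ e u * logical_phase u.
  by rewrite eE -mulrA -exprSr logical4 mulr1.
have trace_sign_sum (I : finType) (P : pred I) (f : I -> F) :
    \prod_(i | P i) trace_sign w C (f i) = trace_sign w C (\sum_(i | P i) f i).
  by rewrite (big_morph _ (trace_signD cardF hw C) (trace_sign0 cardF hw C)).
pose s (u v h : 'rV[F]_5) :=
  trace_sign w C (\sum_(a < 5 | (a < 2)%N) u 0 a * v 0 a * h 0 a).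
have s2 u v h : s u v h ^+ 2 = 1 by rewrite /s /trace_sign sqrr_sign.
(* [G16_trilinear] turns the product of trace signs over the columns into the sign [s] that also
   arises from the two logical qudits. *)
have code_sqr u v : code_phase (u + v) ^+ 2 =
    code_phase u ^+ 2 * code_phase v ^+ 2 * s u v v.
  rewrite /s -G16_trilinear -trace_sign_sum -!prodrXl -!big_split /=.
  by apply: eq_bigr => i _; rewrite mulmxDl mxE (phase_square_add cardF hw).
have logical_sqr u v : logical_phase (u + v) ^+ 2 =
    logical_phase u ^+ 2 * logical_phase v ^+ 2 * s u v v.
  rewrite /s -trace_sign_sum -!prodrXl -!big_split /=.
  by apply: eq_bigr => a _; rewrite mxE (phase_square_add cardF hw).
have code_cub u v h : code_phase (u + v + h) *
    (code_phase u * code_phase v * code_phase h) =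
    code_phase (u + v) * code_phase (u + h) * code_phase (v + h) * s u v h.
  rewrite /s -G16_trilinear -trace_sign_sum -!big_split /=.
  by apply: eq_bigr => i _; rewrite !mulmxDl !mxE (phase_cubic cardF hw).
have logical_cub u v h : logical_phase (u + v + h) *
    (logical_phase u * logical_phase v * logical_phase h) =
    logical_phase (u + v) * logical_phase (u + h) * logical_phase (v + h)
    * s u v h.
  rewrite /s -trace_sign_sum -!big_split /=.
  by apply: eq_bigr => i _; rewrite !mxE (phase_cubic cardF hw).
exists (diagop (fun u => 'i ^+ e u)); split; first exact: diagop_is_diag.
  apply: diagop_clifford => // [u v|u v h].
    have sqrE t : ('i ^+ e t) ^+ 2 =
        code_phase t ^+ 2 * (logical_phase t ^+ 2) ^+ 3.
      by rewrite eE; ring.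
    (* The code phase contributes [s] and the cubed logical phase contributes [s ^+ 3]; together
       [s ^+ 4 = 1]. The cubic identity below closes in the same way. *)
    by rewrite !sqrE code_sqr logical_sqr; ring: (s2 u v v).
  transitivity
    ((code_phase (u + v + h) * (code_phase u * code_phase v * code_phase h)) *
     (logical_phase (u + v + h) *
      (logical_phase u * logical_phase v * logical_phase h)) ^+ 3).
    by rewrite !eE; ring.
  by rewrite code_cub logical_cub !eE; ring: (s2 u v h).
rewrite CS_firstE mul_diagop; apply: eq_diagop => u.
rewrite -/(logical_phase u) -codeE /code_phase.
by rewrite (big_morph _ (exprD _) (expr0 _)).
Qed.

(** * The Z-distance *)

Lemma weight_lt3_support (n : nat) (z : 'rV[F]_n) (i : 'I_n) :
  (hamming_weight z < 3)%N -> z 0 i != 0 ->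
  exists j, forall k, k != i -> k != j -> z 0 k = 0.
Proof.
rewrite /hamming_weight (cardsD1 i) inE => + zi; rewrite zi !ltnS.
case: (set_0Vmem ([set k | z 0 k != 0] :\ i)) => [S0 _|[j Sj]].
  (* In weight one there is no second support position, and [i] itself serves as [j]. *)
  exists i => k neq_ki _; have := in_set0 k.
  by rewrite -S0 !inE neq_ki => /negbFE/eqP.
move=> le1; exists j => k neq_ki neq_kj; apply/eqP/negPn/negP => zk.
have : [set k] \subset ([set k | z 0 k != 0] :\ i) :\ j.
  by rewrite sub1set !inE neq_ki neq_kj zk.
move/subset_leq_card; rewrite cards1.
by move: le1; rewrite (cardsD1 j) Sj ltnS leqn0 => /eqP ->.
Qed.

(* The columns restricted to the rows x, y, 1 are pairwise independent, so no
   nonzero vector of weight at most 2 is orthogonal to these rows. *)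
Lemma G16_distance : Z_distance_is 2 G 3.
Proof.
have [point pointK' pointK] := hcol.
split.
  have w0 := omega_neq0 hw.
  have neq p q : p != q -> (point p == point q) = false.
    by move/negPf <-; apply: (inj_eq (can_inj pointK)).
  pose i0 := point (0, 0); pose i1 := point (1, 0); pose i2 := point (w, 0).
  have n10 : (i1 == i0) = false by rewrite neq // xpair_eqE oner_eq0.
  have n20 : (i2 == i0) = false
    by rewrite neq // xpair_eqE (negPf w0).
  have n21 : (i2 == i1) = false
    by rewrite neq // xpair_eqE (negPf (omega_neq1 cardF hw)).
  (* On the line y = 0 the first row is omega * x^3, which is 0, omega, omega at
     these three points, whereas z is orthogonal to 1, x and y. *)
  pose z : 'rV[F]_16 :=
    w ^+ 2 *: delta_mx 0 i0 + w *: delta_mx 0 i1 + delta_mx 0 i2.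
  have dotE a : rowdot G a z = w ^+ 2 * G a i0 + w * G a i1 + G a i2.
    have dot_delta i :
        \sum_j (delta_mx 0 i : 'rV[F]_16) 0 j * G a j = G a i.
      rewrite (bigD1 i) //= mxE !eqxx mul1r big1 ?addr0 // => j neq_ji.
      by rewrite mxE (negPf neq_ji) andbF mul0r.
    rewrite -(dot_delta i0) -(dot_delta i1) -(dot_delta i2).
    rewrite !big_distrr -!big_split /=.
    by apply: eq_bigr => j _; rewrite !mxE; ring.
  exists z; last first.
    rewrite /hamming_weight (_ : [set i | _] = [set i0; i1; i2]).
      rewrite -setUA !cardsU1 cards1 !inE.
      by rewrite (eq_sym i0 i1) (eq_sym i0 i2) (eq_sym i1 i2) n10 n20 n21.
    apply/setP => i; rewrite !inE !mxE /=.
    case: (i =P i0) => [->|_].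
      rewrite (eq_sym i0 i1) (eq_sym i0 i2) n10 n20 /=.
      by rewrite !mulr0 !addr0 mulr1 expf_neq0.
    case: (i =P i1) => [->|_].
      by rewrite (eq_sym i1 i2) n21 /= !mulr0 !addr0 add0r mulr1.
    by case: (i =P i2) => _; rewrite /= !mulr0 !add0r ?oner_eq0 ?eqxx.
  split.
    (* Row [x] gives [w * 1 + 1 * w = 0], row [y] vanishes at all three points, and row 1 gives
       [w ^+ 2 + w + 1 = 0]. *)
    move=> a le2a; rewrite dotE !mxE !pointK /=.
    case: a le2a => [[|[|[|[|[|]]]]]] //= _ _.
    - by rewrite mulr0 mulr1 add0r (addFF cardF).
    - by rewrite !mulr0 !addr0.
    - by rewrite !mulr1 hw -addrA (addFF cardF).
  (* The first logical row gives [w * w + w = 1]. *)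
  exists ord0 => //; rewrite dotE !mxE !pointK /= !expr0n /= expr1n.
  rewrite (omega3 cardF hw) !(mulr0, mulr1, add0r) -expr2 hw addrAC.
  rewrite (addFF cardF) add0r.
  exact: oner_neq0.
move=> z [stab [a _ dota]]; rewrite leqNgt; apply/negP => lt3.
have [i zi] : exists i, z 0 i != 0.
  apply/existsP; apply: contra_neqT dota => /existsPn z0.
  by apply: big1 => i _; rewrite (eqP (negPn (z0 i))) mul0r.
have [j supp] := weight_lt3_support lt3 zi.
have dot2 (b : 'I_5) : (2 <= b)%N -> j != i ->
    z 0 i * G b i + z 0 j * G b j = 0.
  move=> le2b neq_ji.
  rewrite -(stab b le2b) /rowdot (bigD1 i) //= (bigD1 j) //=.
  rewrite big1 ?addr0 // => k /andP[neq_ki neq_kj].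
  by rewrite (supp _ neq_ki neq_kj) mul0r.
(* In weight one, the row of ones already forces [z 0 i = 0]. In weight two it gives
   [z 0 j = - z 0 i], and then rows [x] and [y] force the two column labels to coincide, against the
   injectivity of [col]. *)
have [eq_ji|neq_ji] := eqVneq j i.
  have := stab (inord 4); rewrite inordK // => /(_ isT).
  rewrite /rowdot (bigD1 i) //= big1 ?addr0; last first.
    by move=> k neq_ki; rewrite supp ?mul0r // eq_ji.
  by rewrite mxE inordK //= mulr1 => /eqP; rewrite (negPf zi).
have zj : z 0 j = - z 0 i.
  have := dot2 (inord 4); rewrite !mxE inordK // => /(_ isT neq_ji) /=.
  by rewrite !mulr1 addrC => /eqP; rewrite addr_eq0 => /eqP.
have eq_coord (b : 'I_5) : (2 <= b)%N -> G b i = G b j.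
  move=> le2b; apply: (mulfI zi); apply/eqP.
  by rewrite -subr_eq0 -mulNr -zj dot2.
have eq_x : (col i).1 = (col j).1.
  by have := eq_coord (inord 2); rewrite !mxE inordK // => /(_ isT).
have eq_y : (col i).2 = (col j).2.
  by have := eq_coord (inord 3); rewrite !mxE inordK // => /(_ isT).
case/eqP: neq_ji; apply: (can_inj pointK').
by rewrite [LHS]surjective_pairing -eq_x -eq_y -surjective_pairing.
Qed.

End Code.

Theorem mainTheorem13 (F : finFieldType) (w : F) (C : numClosedFieldType)
    (col : 'I_16 -> F * F)
    (cardF : #|F| = 4%N) (hw : w ^+ 2 = w + 1) (hcol : bijective col) :
  let G := G16 w col in
  [/\ \rank G = 5%N,
      forall a b c : 'I_5,
        \sum_(i < 16) G a i * G b i * G c i =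
          (if [&& a == b, b == c & (a < 2)%N] then 1 else 0),
      exists U : 'M[C]_#|{: 'rV[F]_5}|,
        [/\ is_diag_mx U, clifford w U & D w C G = U *m CS_first w C 5 2]
    & Z_distance_is 2 G 3].
Proof.
move=> G; split.
- exact: G16_rank.
- exact: G16_triorthogonal.
- exact: G16_clifford.
- exact: G16_distance.
Qed.
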